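(* Let $W\in C^2(\mathbb{R}^N)$ be a radially symmetric potential, bounded from below, which is equal to $-|x|^\alpha/\alpha$ in a neighborhood of the origin. If $\alpha>2$, then a local minimizer $\mu\in\mathcal{P}(\mathbb{R}^N)$ of the interaction energy $E_W$ with respect to $d_\infty$ cannot have a regular $k$-dimensional part for any $1\le k\le N$.
   Context: $\mathcal{P}(\mathbb{R}^N)$ is the set of Borel probability measures on $\mathbb{R}^N$; $B(x,r)$ is the ball of radius $r$ centered at $x$; the support of a measure is the closed set of points all of whose balls of positive radius have positive measure. Interaction energy: $E_W[\mu]=\frac12\iint_{\mathbb{R}^N\times\mathbb{R}^N}W(x-y)\,d\mu(x)\,d\mu(y)$. Distance $d_\infty$: $d_\infty(\mu,\nu)=\inf_{\pi\in\Pi(\mu,\nu)}\sup_{(x,y)\in\mathrm{supp}(\pi)}|x-y|\in[0,+\infty]$, where $\Pi(\mu,\nu)$ is the set of Borel probability measures on $\mathbb{R}^N\times\mathbb{R}^N$ with marginals $\mu$ and $\nu$. A measure $\mu$ is a local minimizer of $E_W$ with respect to $d_\infty$ if there is $\delta>0$ such that $E_W[\mu]\le E_W[\nu]$ for all $\nu\in\mathcal{P}(\mathbb{R}^N)$ with $d_\infty(\mu,\nu)<\delta$. Regular $k$-dimensional part: for $1\le k\le N$ an integer, $\mu\in\mathcal{P}(\mathbb{R}^N)$ has a regular $k$-dimensional part if $\mu=\mu_1+\mu_2$, where $\mu_1$ is a nonnegative measure on $\mathbb{R}^N$ and $\mu_2$ is given by $\int_{\mathbb{R}^N}\psi\,d\mu_2=\int_{\mathcal{M}}\psi(x)f(x)\,d\sigma(x)$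 for all $\psi\in C_0(\mathbb{R}^N)$, for some $C^2$ manifold $\mathcal{M}\subset\mathbb{R}^N$ of dimension $k$ with surface measure $\sigma$ and some nonnegative, not identically zero function $f:\mathcal{M}\to[0,+\infty]$ integrable with respect to $\sigma$, such that moreover there exist $x_0\in\mathcal{M}$ and $c,\kappa>0$ with $f(x)\ge c$ for all $x\in\mathcal{M}\cap B(x_0,\kappa)$.
   Formalization: The formal theorem assumes in addition that the local minimizer has finite interaction energy; without this a measure all of whose d_∞-neighbours have infinite energy (e.g. a Cauchy law with W growing linearly) is a literal local minimizer with a regular part. *)

(* Defs.v *)
From HB Require Import structures.
From mathcomp Require Import all_boot all_order all_algebra.
From mathcomp Require Import all_classical all_reals all_analysis.
From mathcomp Require Import measurable_realfun.
Import Order.TTheory GRing.Theory Num.Theory.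
Import numFieldNormedType.Exports.

Set Implicit Arguments.
Unset Strict Implicit.
Unset Printing Implicit Defensive.

Local Open Scope classical_set_scope.
Local Open Scope ring_scope.

(* [R^N] is ['rV[R]_N].  Its library norm and [ball]s are those of the sup
   norm; they induce the Euclidean topology, hence the right open and Borel
   sets, but metric notions below go through the Euclidean norm [enorm]. *)

Definition borel_rV_display : measure_display.
Proof. exact: default_measure_display. Qed.

Section borel.
Context (R : realType) (n : nat).

Let borel0 : <<s @open 'rV[R]_n >> set0.
Proof. exact: sigma_algebra0. Qed.

Let borelC A : <<s @open 'rV[R]_n >> A -> <<s @open 'rV[R]_n >> (~` A).
Proof. exact: sigma_algebraC. Qed.

Let borel_bigcup (F : (set 'rV[R]_n)^nat) :
  (forall i, <<s @open 'rV[R]_n >> (F i)) ->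
  <<s @open 'rV[R]_n >> (\bigcup_i F i).
Proof. exact: sigma_algebra_bigcup. Qed.

HB.instance Definition _ :=
  @isMeasurable.Build borel_rV_display 'rV[R]_n
    <<s @open 'rV[R]_n >> borel0 borelC borel_bigcup.

End borel.


Section borel_measurability.
Context (R : realType).

Lemma measurable_coord_rV n (i : 'I_n) :
  measurable_fun setT (fun x : 'rV[R]_n => x 0 i : measurableTypeR R).
Proof.
apply: (measurability _ (RGenOpens.measurableE R)).
move=> _ [_ [a [b ->]] <-]; rewrite setTI; apply: sub_sigma_algebra.
apply: open_comp; last exact: interval_open.
by move=> x _; exact: coord_continuous.
Qed.

Lemma measurable_fun_rV d (T : measurableType d) n (f : T -> 'rV[R]_n) :
  (forall i, measurable_fun setT (fun t => f t 0 i : measurableTypeR R)) ->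
  measurable_fun setT f.
Proof.
move=> mf; apply: (@measurability _ _ _ _ _ f (@open 'rV[R]_n)) => //.
move=> _ [U oU <-]; rewrite setTI.
pose c (q : 'rV[rat]_n) : 'rV[R]_n := map_mx ratr q.
pose I := [set q : 'rV[rat]_n * rat | ball (c q.1) (ratr q.2) `<=` U].
have -> : U = \bigcup_(q in I) ball (c q.1) (ratr q.2).
  apply/seteqP; split=> [x Ux|x [q Iq /Iq]//].
  have /nbhs_ballP[e /= e0 xeU] : nbhs x U by exact: open_nbhs_nbhs.
  have e20 : 0 < e / 2 by rewrite divr_gt0.
  have [r] := rat_in_itvoo e20.
  rewrite in_itv /= => /andP[r0 re].
  have qP (i : 'I_n) : exists q : rat, ball (ratr q : R) (ratr r) (x 0 i).
    have /rat_in_itvoo[q] : x 0 i - ratr r < x 0 i + ratr r.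
      by rewrite ltrBlDr -addrA ltrDl addr_gt0.
    by rewrite in_itv /= => qi; exists q; rewrite /ball/= distrC ltr_distlC.
  pose q := \row_i sval (cid (qP i)).
  have xq : ball (c q) (ratr r) x.
    split=> // i j; rewrite !mxE ord1.
    by case: cid.
  exists (q, r) => //= y qy; apply: xeU.
  rewrite [e]splitr; apply: (@ball_triangle _ _ (c q)).
    by apply/ball_sym; apply: le_ball xq; exact: ltW.
  by apply: le_ball qy; exact: ltW.
rewrite preimage_bigcup bigcup_mkcond.
apply: countable_bigcupT_measurable => // -[q r].
case: ifPn => // _.
have [r0|r0] := ltP 0 (ratr r : R); last first.
  rewrite (_ : _ @^-1` _ = set0) //.
  by apply/seteqP; split=> t //= -[]; rewrite ltNge r0.
rewrite (_ : _ @^-1` _ =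
    \bigcap_(i in [set: 'I_n])
      ((fun t => f t 0 i) @^-1` ball (ratr (q 0 i) : R) (ratr r))).
  apply: fin_bigcap_measurable => [|i _]; first exact: finite_finset.
  rewrite -[X in measurable X]setTI; apply: mf => //.
  exact: measurable_ball.
apply/seteqP; split=> [t [_ tq] i _|t tq].
  by have /= := tq 0 i; rewrite mxE.
by split=> // i j; rewrite ord1 mxE; exact: tq.
Qed.

End borel_measurability.

Section lebesgue_step.
Context (R : realType) (n : nat).
Variable m : {sigma_finite_measure set 'rV[R]_n -> \bar R}.

Definition cons_rV (z : measurableTypeR R * 'rV[R]_n) : 'rV[R]_n.+1 :=
  row_mx (const_mx z.1 : 'rV[R]_1) z.2.

Lemma measurable_cons_rV : measurable_fun setT cons_rV.
Proof.
apply: measurable_fun_rV => i.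
have [j ->|j ->] := split_ordP (i : 'I_(1 + n)).
  rewrite [X in measurable_fun _ X](_ : _ = fst); first exact: measurable_fst.
  by apply/funext => z; rewrite /cons_rV [LHS]row_mxEl mxE.
rewrite [X in measurable_fun _ X](_ : _ = (fun x : 'rV[R]_n => x 0 j) \o snd).
  by apply: measurableT_comp => //; exact: measurable_coord_rV.
by apply/funext => z; rewrite /cons_rV [LHS]row_mxEr.
Qed.

Definition lebesgue_step : set 'rV[R]_n.+1 -> \bar R :=
  pushforward (@lebesgue_measure R \x m)%E cons_rV.

HB.instance Definition _ := isMeasurableFun.Build _ _ _ _ _ measurable_cons_rV.

Let step0 : lebesgue_step set0 = 0%E.
Proof. exact: measure0. Qed.

Let step_ge0 A : (0 <= lebesgue_step A)%E.
Proof. exact: measure_ge0. Qed.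

Let step_sigma_additive : semi_sigma_additive lebesgue_step.
Proof. exact: measure_semi_sigma_additive. Qed.

HB.instance Definition _ := isMeasure.Build _ _ _
  lebesgue_step step0 step_ge0 step_sigma_additive.

Let step_sigma_finite : sigma_finite setT lebesgue_step.
Proof.
have /sigma_finiteP[F [FT ndF Foo]] := sigma_finiteT (@lebesgue_measure R).
have /sigma_finiteP[G [GT ndG Goo]] := sigma_finiteT m.
pose split_rV (x : 'rV[R]_n.+1) : measurableTypeR R * 'rV[R]_n :=
  (x 0 0, @rsubmx R 1 1 n x).
have cK z : split_rV (cons_rV z) = z.
  case: z => t y; rewrite /split_rV /cons_rV /= row_mxKr; congr pair.
  have -> : 0 = @lshift 1 n 0 by exact/val_inj.
  by rewrite [LHS]row_mxEl mxE.
have ms : measurable_fun setT split_rV.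
  apply: measurable_fun_pair; first exact: measurable_coord_rV.
  apply: measurable_fun_rV => i.
  under eq_fun do rewrite mxE.
  exact: measurable_coord_rV.
exists (fun i => split_rV @^-1` (F i `*` G i)).
  rewrite -preimage_bigcup (_ : \bigcup_i _ = setT) ?preimage_setT //.
  rewrite -setXTT FT GT predeqE => -[x y]; split; last first.
    by move=> [/= [i _ Fix] [j _ Gjy]]; exists (maxn i j) => //; split;
      [move: x Fix; exact/subsetPset/ndF/leq_maxl
      |move: y Gjy; exact/subsetPset/ndG/leq_maxr].
  by move=> [i _ []/= ? ?]; split; exists i.
move=> i; have [mFi Fi] := Foo i; have [mGi Gi] := Goo i; split.
  by rewrite -[X in measurable X]setTI; apply: ms => //; exact: measurableX.
rewrite /lebesgue_step /pushforward -comp_preimage.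
rewrite (_ : _ \o _ = id); last by apply/funext => z; exact: cK.
by rewrite preimage_id product_measure1E// lte_mul_pinfty// ge0_fin_numE.
Qed.

HB.instance Definition _ := Measure_isSigmaFinite.Build _ _ _
  lebesgue_step step_sigma_finite.

End lebesgue_step.


(* Lebesgue measure on [R^n], as the n-fold product of the one on [R]. *)
Fixpoint lebesgue_rV (R : realType) (n : nat) :
    {sigma_finite_measure set 'rV[R]_n -> \bar R} :=
  if n is n'.+1 then lebesgue_step (lebesgue_rV R n') else \d_ (0 : 'rV[R]_0).

Section euclidean.
Context {R : realType} {n : nat}.
Implicit Types x y : 'rV[R]_n.

Definition enorm x : R := Num.sqrt (\sum_i x 0 i ^+ 2).

Definition eball x (r : R) : set 'rV[R]_n := [set y | enorm (y - x) < r].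

Definition eball2 (z : 'rV[R]_n * 'rV[R]_n) (r : R) :
    set ('rV[R]_n * 'rV[R]_n) :=
  [set z' | Num.sqrt (enorm (z'.1 - z.1) ^+ 2 + enorm (z'.2 - z.2) ^+ 2) < r].

Definition vanishing_continuous (psi : 'rV[R]_n -> R) : Prop :=
  continuous psi /\
  forall e, 0 < e -> exists r, forall x, r < enorm x -> `|psi x| < e.

End euclidean.

Section energy.
Context {R : realType} {N : nat}.
Local Notation RN := 'rV[R]_N.
Local Open Scope ereal_scope.

Definition interaction_energy (W : RN -> R) (mu : probability RN R) : \bar R :=
  (2^-1)%:E * \int[mu \x mu]_z (W (z.1 - z.2)%R)%:E.

(* Since [RN] is second countable, the product sigma-algebra of [RN * RN] is
   its Borel sigma-algebra. *)
Definition coupling (mu nu : probability RN R) :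
    set (probability (RN * RN)%type R) :=
  [set pi | (forall A, measurable A -> pi (fst @^-1` A) = mu A) /\
            (forall A, measurable A -> pi (snd @^-1` A) = nu A)].

Definition support2 (pi : probability (RN * RN)%type R) : set (RN * RN) :=
  [set z | forall r : R, (0 < r)%R -> 0 < pi (eball2 z r)].

Definition dinfty (mu nu : probability RN R) : \bar R :=
  ereal_inf [set ereal_sup [set (enorm (z.1 - z.2)%R)%:E | z in support2 pi]
            | pi in coupling mu nu].

Definition local_minimizer (W : RN -> R) (mu : probability RN R) : Prop :=
  exists2 delta : R, (0 < delta)%R &
    forall nu : probability RN R, dinfty mu nu < delta%:E ->
      interaction_energy W mu <= interaction_energy W nu.

End energy.

Section C2.
Context {R : realType} {V V' : normedModType R}.
Implicit Types (U : set V) (f : V -> V').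

(* Meant for open [U].  In finite dimension, the continuity of all
   [fun x => 'D_v f x] is that of the differential. *)
Definition C1_on U f : Prop :=
  (forall x, U x -> differentiable f x) /\
  (forall v x, U x -> {for x, continuous ('D_v f)}).

Definition C2_on U f : Prop := C1_on U f /\ forall v, C1_on U ('D_v f).

End C2.

Section submanifold.
Context {R : realType} {N : nat} (k : nat).
Implicit Types (M : set 'rV[R]_N) (U : set 'rV[R]_k)
  (phi : 'rV[R]_k -> 'rV[R]_N).

(* [phi] is an injective C^2 immersion of the open set [U], and a homeomorphism
   of [U] onto a relatively open subset of [M]: the last clause says that it is
   open as a map into [M].  ['J phi u] is [k x N], as it acts on rows. *)
Definition chart M U phi : Prop :=
  [/\ open U, C2_on U phi, (forall u, U u -> row_free ('J phi u)),
      {in U &, injective phi} &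
      forall A, open A -> A `<=` U -> exists2 B, open B & phi @` A = M `&` B].

Definition C2_submanifold M : Prop :=
  forall p, M p -> exists U phi, chart M U phi /\ (phi @` U) p.

Definition area_element phi (u : 'rV[R]_k) : R :=
  Num.sqrt (\det ('J phi u *m ('J phi u)^T)).

(* The surface measure of [M], extended by [0] to the Borel subsets of [R^N];
   countably many charts cover [M], so this determines [sigma]. *)
Definition surface_measure M (sigma : {measure set 'rV[R]_N -> \bar R}) : Prop :=
  sigma (~` M) = 0%E /\
  forall U phi, chart M U phi -> forall A, measurable A -> A `<=` U ->
    sigma (phi @` A) = (\int[lebesgue_rV R k]_(u in A) (area_element phi u)%:E)%E.

(* [f] is only relevant on [M]. *)
Definition regular_part (mu : probability 'rV[R]_N R) : Prop :=
  exists (mu1 mu2 sigma : {measure set 'rV[R]_N -> \bar R})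
         (M : set 'rV[R]_N) (f : 'rV[R]_N -> \bar R),
  [/\ (forall A, measurable A -> mu A = (mu1 A + mu2 A)%E),
      C2_submanifold M /\ surface_measure M sigma,
      [/\ forall x, M x -> (0 <= f x)%E,
          exists2 x, M x & f x != 0%E &
          sigma.-integrable M f],
      (forall psi, vanishing_continuous psi ->
        (\int[mu2]_x (psi x)%:E = \int[sigma]_(x in M) ((psi x)%:E * f x))%E) &
      exists x0 (c kappa : R), [/\ M x0, 0 < c, 0 < kappa &
        forall x, M x -> eball x0 kappa x -> (c%:E <= f x)%E]].

End submanifold.

(* Main.v *)
Require Import Defs.
From mathcomp Require Import all_boot all_order all_algebra.
From mathcomp Require Import all_classical all_reals all_analysis.
From mathcomp Require Import measurable_realfun ring lra.
Import Order.TTheory GRing.Theory Num.Theory.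
Import numFieldNormedType.Exports.

(** Write [E[mu]] as one half of the quadratic form [I(mu, mu)], where
    [I(a, b)] is the double integral of [W (x - y)]. If [mu = r + p + q] with
    nonnegative [p] and [q] of equal mass living on a set of diameter less than
    [delta], then [r + 2p] and [r + 2q] are both obtained from [mu] by moving
    mass inside that set, so both are at [d_infty]-distance less than [delta]
    from [mu]. Adding the two inequalities of local minimality, the first-order
    terms cancel and what remains is
    [I(p, q) + I(q, p) <= I(p, p) + I(q, q)] ([second_variation]).

    Take three points [x1], [x2], [x0] close to each other in the support of
    [mu]. Let [p] charge tiny balls around [x1] and [x2] with mass [s] each, and
    let [q] charge a tiny ball around [x0] with mass [2s]. As the balls shrink,
    the inequality becomes a condition on [W] at the differences of the three
    points ([three_point_condition]). For [W = - |x|^alpha / alpha] it reads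
    [|x1 - x2|^alpha <= 2 |x1 - x0|^alpha + 2 |x2 - x0|^alpha].
    If [x0] were the midpoint of [x1] and [x2] this would say [2^alpha <= 4],
    that is, [alpha <= 2].

    So a support cannot contain a C^1 arc when [alpha > 2]: along an arc
    [phi (u + h e)] with velocity [v <> 0], the points [phi (u + h e)],
    [phi (u - h e)] and [phi u] are asymptotic to [phi u + h v], [phi u - h v]
    and [phi u], and the condition fails for small [h] ([symmetric_chords]).

    A regular [k]-dimensional part with [k >= 1] puts such arcs in the support
    ([regular_part_charges]): near [x_0] the density is at least [c], and every
    relatively open piece of the manifold has positive surface measure, because
    the area element of a chart is continuous and positive
    ([chart_image_measure_gt0]). *)

Set Implicit Arguments.
Unset Strict Implicit.
Unset Printing Implicit Defensive.

Local Open Scope classical_set_scope.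
Local Open Scope ring_scope.

(** * Measures *)

Section measures.
Context d (T : measurableType d) (R : realType).
Implicit Types m : {measure set T -> \bar R}.

(** Sums of measures carry no canonical finiteness; this brings them back into
    the type for which product measures and Fubini's theorem are available. *)
Lemma finite_measure_of m : (m setT < +oo)%E ->
  {m' : {finite_measure set T -> \bar R} | forall A, m' A = m A}.
Proof.
move=> moo; exists (mfrestr measurableT moo) => A.
by rewrite /= /mfrestr /mrestr setIT.
Qed.

Lemma probability_of m : (m setT = 1)%E ->
  {m' : probability T R | forall A, m' A = m A}.
Proof.
move=> m1; exists (mnormalize m (dirac point)) => A.
by rewrite /= /mnormalize m1 onee_eq0/= invr1 mule1.
Qed.

Lemma integral_measure_split (m m1 m2 : {measure set T -> \bar R})
    (f : T -> \bar R) :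
  (forall A, measurable A -> m A = (m1 A + m2 A)%E) ->
  (forall x, (0 <= f x)%E) -> measurable_fun setT f ->
  (\int[m]_x f x = \int[m1]_x f x + \int[m2]_x f x)%E.
Proof.
move=> mE f0 mf; rewrite -ge0_integral_measure_add//.
apply: eq_measure_integral => A mA _.
by rewrite mE//; exact/esym/measure_addE.
Qed.

End measures.

Lemma measurable_continuous_rV (R : realType) n (f : 'rV[R]_n -> R) :
  continuous f -> measurable_fun setT f.
Proof.
move=> cf; apply: (measurability _ (RGenOpens.measurableE R)).
move=> _ [_ [a [b ->]] <-]; rewrite setTI; apply: sub_sigma_algebra.
by apply: open_comp; [move=> x _; exact: cf|exact: interval_open].
Qed.

Lemma measurable_open_rV (R : realType) n (A : set 'rV[R]_n) :
  open A -> measurable A.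
Proof. exact: sub_sigma_algebra. Qed.

(** * The interaction of two measures *)

Section interaction.
Context {R : realType} {N : nat}.
Local Notation RN := 'rV[R]_N.
Implicit Types (w : RN -> R) (a b : {finite_measure set RN -> \bar R}).

Lemma measurable_subr_rV :
  measurable_fun setT (fun z : RN * RN => z.1 - z.2).
Proof.
apply: measurable_fun_rV => i.
under eq_fun do rewrite mxE mxE.
apply: measurable_funB.
  apply: (measurableT_comp (measurable_coord_rV i)); exact: measurable_fst.
apply: (measurableT_comp (measurable_coord_rV i)); exact: measurable_snd.
Qed.

Local Open Scope ereal_scope.

Definition interaction w a b := \int[a]_x \int[b]_y (w (x - y)%R)%:E.

(** For a nonnegative kernel, bilinearity and Fubini's theorem hold in the
    extended reals; [W] is reduced to this case by adding a constant. *)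
Section bilinear.
Variable w : RN -> R.
Hypothesis w0 : forall x, (0 <= w x)%R.
Hypothesis cw : continuous w.

Let mw : measurable_fun setT (fun z : RN * RN => (w (z.1 - z.2)%R)%:E).
Proof.
apply/measurable_EFinP.
exact: (measurableT_comp (measurable_continuous_rV cw) measurable_subr_rV).
Qed.

Let mF b : measurable_fun setT (fun x : RN => \int[b]_y (w (x - y)%R)%:E).
Proof.
have f0 (z : RN * RN) : 0 <= (w (z.1 - z.2)%R)%:E by rewrite lee_fin.
have := @measurable_fun_fubini_tonelli_F _ _ _ _ _ b _ mw f0.
by [].
Qed.

Let mwx x : measurable_fun setT (fun y : RN => (w (x - y)%R)%:E).
Proof. exact: (measurableT_comp mw (measurable_pair1 x)). Qed.

Lemma interaction_ge0 a b : 0 <= interaction w a b.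
Proof.
by apply: integral_ge0 => x _; apply: integral_ge0 => y _; rewrite lee_fin.
Qed.

Lemma interactionDl a a1 a2 b :
  (forall A, measurable A -> a A = a1 A + a2 A) ->
  interaction w a b = interaction w a1 b + interaction w a2 b.
Proof.
move=> aE; apply: integral_measure_split => // x.
by apply: integral_ge0 => y _; rewrite lee_fin.
Qed.

Lemma interactionDr a b b1 b2 :
  (forall A, measurable A -> b A = b1 A + b2 A) ->
  interaction w a b = interaction w a b1 + interaction w a b2.
Proof.
move=> bE; rewrite /interaction.
rewrite -ge0_integralD//.
- apply: eq_integral => x _; apply: (integral_measure_split bE) => //.
  by move=> y; rewrite lee_fin.
- by move=> x _; apply: integral_ge0 => y _; rewrite lee_fin.
- by move=> x _; apply: integral_ge0 => y _; rewrite lee_fin.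
Qed.

Lemma interactionE a b :
  \int[a \x b]_z (w (z.1 - z.2)%R)%:E = interaction w a b.
Proof. by rewrite fubini_tonelli1// => z; rewrite lee_fin. Qed.

Lemma ae_concentrated (a : {measure set RN -> \bar R}) (A : set RN)
    (P : RN -> Prop) :
  measurable A -> a (~` A) = 0 -> (forall x, A x -> P x) -> {ae a, forall x, P x}.
Proof.
move=> mA aA AP; exists (~` A); split => //; first exact: measurableC.
by move=> x /= nP /AP.
Qed.

Lemma interaction_le a b (A B : set RN) (C : R) : measurable A -> measurable B ->
  a (~` A) = 0 -> b (~` B) = 0 -> (0 <= C)%R ->
  (forall x y, A x -> B y -> (w (x - y) <= C)%R) ->
  interaction w a b <= C%:E * (a setT * b setT).
Proof.
move=> mA mB aA bB C0 wC.
rewrite muleCA muleC -[C%:E * _]integral_cst// -integral_cst//.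
apply: ae_ge0_le_integral => //.
- by move=> x _; apply: integral_ge0 => y _; rewrite lee_fin.
- by move=> x _; apply: integral_ge0 => y _; rewrite lee_fin.
apply: (ae_concentrated mA aA) => x Ax _.
apply: ae_ge0_le_integral; rewrite ?lee_fin//; try by move=> y _; rewrite lee_fin.
apply: (ae_concentrated mB bB) => y By _.
by rewrite lee_fin wC.
Qed.

Lemma interaction_ge a b (A B : set RN) (C : R) : measurable A -> measurable B ->
  a (~` A) = 0 -> b (~` B) = 0 -> (0 <= C)%R ->
  (forall x y, A x -> B y -> (C <= w (x - y))%R) ->
  C%:E * (a setT * b setT) <= interaction w a b.
Proof.
move=> mA mB aA bB C0 wC.
rewrite muleCA muleC -[C%:E * _]integral_cst// -integral_cst//.
apply: ae_ge0_le_integral => //.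
- by move=> x _; apply: integral_ge0 => y _; rewrite lee_fin.
- by move=> x _; apply: integral_ge0 => y _; rewrite lee_fin.
apply: (ae_concentrated mA aA) => x Ax _.
apply: ae_ge0_le_integral; rewrite ?lee_fin//; try by move=> y _; rewrite lee_fin.
apply: (ae_concentrated mB bB) => y By _.
by rewrite lee_fin wC.
Qed.

End bilinear.
End interaction.

(** * Limits of finite sums, products and determinants *)

Section finite_limits.
Context {R : realType} {T : Type} {F : set_system T} {FF : Filter F}.

Lemma cvg_sumr (I : Type) (r : seq I) (P : pred I) (f : I -> T -> R) (l : I -> R) :
  (forall i, f i @ F --> l i) ->
  (fun x => \sum_(i <- r | P i) f i x) @ F --> \sum_(i <- r | P i) l i.
Proof.
move=> fl; elim: r => [|i r IH].
  rewrite big_nil (_ : (fun x => _) = cst 0); first exact: cvg_cst.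
  by apply/funext => x; rewrite big_nil.
rewrite big_cons; under eq_fun do rewrite big_cons.
by case: (P i) => //; exact: cvgD.
Qed.

Lemma cvg_prodr (I : Type) (r : seq I) (P : pred I) (f : I -> T -> R) (l : I -> R) :
  (forall i, f i @ F --> l i) ->
  (fun x => \prod_(i <- r | P i) f i x) @ F --> \prod_(i <- r | P i) l i.
Proof.
move=> fl; elim: r => [|i r IH].
  rewrite big_nil (_ : (fun x => _) = cst 1); first exact: cvg_cst.
  by apply/funext => x; rewrite big_nil.
rewrite big_cons; under eq_fun do rewrite big_cons.
by case: (P i) => //; exact: cvgM.
Qed.

Lemma cvg_det n (A : T -> 'M[R]_n) (B : 'M[R]_n) :
  (forall i j, (fun x => A x i j) @ F --> B i j) ->
  (fun x => \det (A x)) @ F --> \det B.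
Proof.
move=> AB; apply: cvg_sumr => s.
by apply: cvgM; [exact: cvg_cst|exact: cvg_prodr].
Qed.

End finite_limits.

(** * The Euclidean norm *)

Section euclidean_norm.
Context {R : realType} {n : nat}.
Implicit Types x y : 'rV[R]_n.

Lemma enorm_ge0 x : 0 <= enorm x. Proof. exact: sqrtr_ge0. Qed.

Lemma enormZ (h : R) x : enorm (h *: x) = `|h| * enorm x.
Proof.
rewrite /enorm -sqrtr_sqr -sqrtrM ?sqr_ge0//; congr Num.sqrt.
by rewrite mulr_sumr; apply: eq_bigr => i _; rewrite mxE exprMn.
Qed.

Lemma enormN x : enorm (- x) = enorm x.
Proof. by rewrite -scaleN1r enormZ normrN1 mul1r. Qed.

Lemma enorm0 : enorm (0 : 'rV[R]_n) = 0.
Proof. by rewrite -(scale0r 0) enormZ normr0 mul0r. Qed.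

Lemma coord_le_enorm x i : `|x 0 i| <= enorm x.
Proof.
rewrite -sqrtr_sqr ler_wsqrtr// (bigD1 i)//= lerDl sumr_ge0// => j _.
exact: sqr_ge0.
Qed.

Lemma coord_le_norm x i : `|x 0 i| <= `|x|.
Proof.
have -> : `|x| = mx_norm x by [].
rewrite mx_normrE; apply/bigmax_geP; right => /=.
by exists (0, i).
Qed.

Lemma norm_le_enorm x : `|x| <= enorm x.
Proof.
have [x0|] := eqVneq (mx_norm x) 0; first by rewrite [leLHS]x0 enorm_ge0.
by case/mx_norm_neq0 => -[i j] xij; rewrite [leLHS]xij ord1 coord_le_enorm.
Qed.

Lemma enorm_le_norm x : enorm x <= n%:R * `|x|.
Proof.
rewrite -[leRHS]ger0_norm ?mulr_ge0// -sqrtr_sqr ler_wsqrtr//.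
have xi (i : 'I_n) : true -> x 0 i ^+ 2 <= `|x| ^+ 2.
  by move=> _; rewrite -(real_normK (num_real (x 0 i))) lerXn2r ?nnegrE// coord_le_norm.
apply: le_trans (ler_sum _ xi) _.
rewrite sumr_const card_ord -[leLHS]mulr_natl exprMn ler_wpM2r ?sqr_ge0//.
by rewrite -natrX ler_nat; case: (n) => // m; rewrite leq_pmulr.
Qed.

Lemma enorm_gt0 x : x != 0 -> 0 < enorm x.
Proof. by rewrite -normr_gt0 => /lt_le_trans; apply; exact: norm_le_enorm. Qed.

Lemma continuous_enorm : continuous (@enorm R n).
Proof.
move=> x; apply: (continuous_comp _ (@sqrt_continuous R _)).
apply: (@cvg_sumr _ _ (nbhs x)) => i.
by apply: cvgM; exact: coord_continuous.
Qed.

End euclidean_norm.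

(** * Energy and interaction *)

(** Both sides may be infinite. The negative part of [g] is bounded by [M], so
    it has a finite integral; adding it to both sides leaves an identity between
    integrals of nonnegative functions. *)
Lemma integral_add_cst d (T : measurableType d) (R : realType)
    (P : probability T R) (g : T -> R) (M : R) :
  measurable_fun setT g -> 0 <= M -> (forall x, - M <= g x) ->
  (\int[P]_x (g x)%:E = \int[P]_x (g x + M)%:E - M%:E)%E.
Proof.
move=> mg M0 gM; pose f x := (g x)%:E.
have mf : measurable_fun setT f by exact/measurable_EFinP.
have mfp : measurable_fun setT f^\+%E by exact: measurable_funepos.
have mfn : measurable_fun setT f^\-%E by exact: measurable_funeneg.
have intM : (\int[P]_x M%:E = M%:E)%E.
  rewrite integral_cst; last exact: measurableT.
  by rewrite -[RHS]mule1; congr (_ * _)%E; exact: probability_setT.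
have fnM : (\int[P]_x f^\-%E x <= M%:E)%E.
  rewrite -intM; apply: ge0_le_integral => //.
  move=> x _; rewrite funenegE /f -EFinN -EFin_max lee_fin ge_max M0 andbT.
  by rewrite lerNl.
have fn0 : (0 <= \int[P]_x f^\-%E x)%E by apply: integral_ge0.
have fnfin : (\int[P]_x f^\-%E x)%E \is a fin_num.
  by rewrite ge0_fin_numE// (le_lt_trans fnM)// ltry.
have : (\int[P]_x f^\+%E x + M%:E = \int[P]_x (g x + M)%:E + \int[P]_x f^\-%E x)%E.
  rewrite -{1}intM -!ge0_integralD//.
  - apply: eq_integral => x _; rewrite funeposE funenegE /f /=.
    rewrite -?EFinN -!EFin_max -!EFinD; congr EFin.
    by rewrite /Num.max; do 2 case: ifPn; lra.
  - by move=> x _; rewrite lee_fin; have := gM x; lra.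
  - by apply/measurable_EFinP; exact: measurable_funD.
rewrite -/f [X in _ -> X = _]integralE.
move: fnfin; case: (\int[P]_x f^\-%E x)%E => // c _.
case: (\int[P]_x f^\+%E x)%E => [a||]; case: (\int[P]_x (g x + M)%:E)%E => [b||] //=.
by move=> -[abc]; rewrite -!EFinB; congr EFin; lra.
Qed.

Lemma interaction_energyE (R : realType) N (W : 'rV[R]_N -> R) (M : R)
    (mu : probability 'rV[R]_N R) :
  continuous W -> 0 <= M -> (forall x, - M <= W x) ->
  interaction_energy W mu =
  ((2^-1)%:E * (interaction (fun x => (W x + M)%R) mu mu - M%:E))%E.
Proof.
move=> cW M0 WM; rewrite /interaction_energy; congr (_ * _)%E.
rewrite (@integral_add_cst _ _ _ _ _ M)//; last first.
  exact: (measurableT_comp (measurable_continuous_rV cW) measurable_subr_rV).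
rewrite -interactionE//.
  by move=> x; have := WM x; lra.
by move=> x; apply: continuousD; [exact: cW|exact: cst_continuous].
Qed.

(** * Transport plans with small displacement *)

Section transport.
Context {R : realType} {N : nat}.
Local Notation RN := 'rV[R]_N.

Definition diag_rV (x : RN) : RN * RN := (x, x).

Lemma measurable_diag_rV : measurable_fun setT diag_rV.
Proof. by apply: measurable_fun_pair. Qed.

Lemma measurable_eball2 (z : RN * RN) (r : R) : measurable (eball2 z r).
Proof.
have me (x : RN) : measurable_fun setT (fun y : RN => enorm (y - x)).
  apply: measurable_continuous_rV => y.
  apply: (@continuous_comp _ _ _ (fun y : RN => y - x) (@enorm R N)); last first.
    exact: continuous_enorm.
  by apply: continuousB; [exact: cvg_id|exact: cst_continuous].
rewrite -[X in measurable X]setTI.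
pose g (z' : RN * RN) := Num.sqrt (enorm (z'.1 - z.1) ^+ 2 + enorm (z'.2 - z.2) ^+ 2).
have mg : measurable_fun setT g.
  apply: measurableT_comp.
    by apply: continuous_measurable_fun; exact: sqrt_continuous.
  apply: measurable_funD; apply: measurable_funX.
    exact: (measurableT_comp (me _) measurable_fst).
  exact: (measurableT_comp (me _) measurable_snd).
rewrite (_ : eball2 z r = g @^-1` `]-oo, r[%classic).
  by apply: mg => //; exact: measurable_itv.
by apply/seteqP; split => z' /=; rewrite in_itv.
Qed.

Lemma measurable_far (rho : R) :
  measurable [set z : RN * RN | rho < enorm (z.1 - z.2)].
Proof.
rewrite -[X in measurable X]setTI.
have mg : measurable_fun setT (fun z : RN * RN => enorm (z.1 - z.2)).
  apply: (measurableT_comp _ measurable_subr_rV).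
  by apply: measurable_continuous_rV; exact: continuous_enorm.
rewrite (_ : [set _ | _] = (fun z : RN * RN => enorm (z.1 - z.2)) @^-1` `]rho, +oo[%classic).
  by apply: mg => //; exact: measurable_itv.
by apply/seteqP; split => z' /=; rewrite in_itv /= andbT.
Qed.

(** The support is no larger than any closed set of full measure: a point at
    which [enorm (z.1 - z.2)] exceeds [rho] has a neighbourhood where it still
    does, and [pi] gives that neighbourhood mass zero. *)
Lemma support2_near (pi : probability (RN * RN)%type R) (rho : R) z :
  pi [set z | rho < enorm (z.1 - z.2)] = 0%E -> support2 pi z ->
  enorm (z.1 - z.2) <= rho.
Proof.
move=> pi0 zpi; rewrite leNgt; apply/negP => rhoz.
have : \forall z' \near z, rho < enorm (z'.1 - z'.2).
  have cg : {for z, continuous (fun z : RN * RN => enorm (z.1 - z.2))}.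
    apply: (@continuous_comp _ _ _ (fun z : RN * RN => z.1 - z.2) (@enorm R N)).
      by apply: cvgB; [exact: cvg_fst|exact: cvg_snd].
    exact: continuous_enorm.
  exact: (cvgr_gt (enorm (z.1 - z.2)) cg).
move=> /nbhs_ballP[e /= e0 ze].
have := zpi e e0; rewrite ltNge => /negP; apply.
rewrite -pi0; apply: le_measure; rewrite ?inE.
- exact: measurable_eball2.
- exact: measurable_far.
move=> z' /= z'z; apply: (ze z').
have le1 : enorm (z'.1 - z.1) < e.
  apply: le_lt_trans z'z; rewrite -[leLHS]ger0_norm ?enorm_ge0// -sqrtr_sqr.
  by rewrite ler_wsqrtr// lerDl sqr_ge0.
have le2 : enorm (z'.2 - z.2) < e.
  apply: le_lt_trans z'z; rewrite -[leLHS]ger0_norm ?enorm_ge0// -sqrtr_sqr.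
  by rewrite ler_wsqrtr// lerDr sqr_ge0.
have bz (x y : RN) : enorm (y - x) < e -> ball x e y.
  by rewrite -ball_normE /= distrC; apply: le_lt_trans; exact: norm_le_enorm.
by split; exact: bz.
Qed.

(** The plan keeps the common part [s] in place, along the diagonal, and sends
    [q] to [p] by the normalized product [q \x p]; only the latter displaces
    mass, and it does so inside [K]. *)
Lemma dinfty_le (mu nu : probability RN R)
    (s p q : {finite_measure set RN -> \bar R}) (K : set RN) (rho : R) :
  (forall A, measurable A -> mu A = (s A + q A)%E) ->
  (forall A, measurable A -> nu A = (s A + p A)%E) ->
  p setT = q setT -> (0 < p setT)%E ->
  measurable K -> p (~` K) = 0%E -> q (~` K) = 0%E -> 0 <= rho ->
  (forall x y, K x -> K y -> enorm (x - y) <= rho) ->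
  (dinfty mu nu <= rho%:E)%E.
Proof.
move=> muE nuE pq p0 mK pK qK rho0 Krho.
have pfin : p setT \is a fin_num by exact: fin_num_measure.
pose P := fine (p setT).
have P0 : 0 < P by rewrite fine_gt0// p0 ltey_eq pfin.
have PE : p setT = P%:E by rewrite fineK.
have Pi0 : 0 <= P^-1 by rewrite invr_ge0 ltW.
pose prod_qp := (q \x p)%E.
pose pi00 := measure_add (pushforward s diag_rV) (mscale (NngNum Pi0) prod_qp).
pose pi0 := pi00 measurable_diag_rV.
have pi0E A : pi0 A = (s (diag_rV @^-1` A) + (P^-1)%:E * (q \x p)%E A)%E.
  exact: measure_addE.
have PK : ((P^-1)%:E * p setT = 1)%E by rewrite PE -EFinM mulVf ?gt_eqF.
have pi0T : pi0 setT = 1%E.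
  rewrite pi0E preimage_setT -setXTT product_measure1E// muleCA PK mule1.
  by rewrite -[RHS](probability_setT mu) muE.
have [pi pi_pi0] := probability_of pi0T.
have piE A : pi A = (s (diag_rV @^-1` A) + (P^-1)%:E * (q \x p)%E A)%E.
  by rewrite pi_pi0; exact: pi0E.
have pi_far : pi [set z | rho < enorm (z.1 - z.2)] = 0%E.
  rewrite piE.
  rewrite (_ : _ @^-1` _ = set0) ?measure0 ?add0e; last first.
    by apply/seteqP; split => x //=; rewrite subrr enorm0 ltNge rho0.
  have mKC : measurable (~` K) by exact: measurableC.
  rewrite (_ : (_ \x _)%E _ = 0%E) ?mule0//.
  apply/eqP; rewrite -measure_le0.
  have U0 : ((q \x p) (((~` K) `*` setT) `|` (setT `*` (~` K))) = 0)%E.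
    apply/eqP; rewrite -measure_le0.
    have [m1 m2] : measurable ((~` K) `*` [set: RN]) /\ measurable ([set: RN] `*` (~` K)).
      by split; exact: measurableX.
    apply: le_trans (measureU2 _ m1 m2) _.
    have e1 : ((q \x p) ((~` K) `*` setT) <= 0)%E.
      by rewrite product_measure1E//= qK mul0e.
    have e2 : ((q \x p) (setT `*` (~` K)) <= 0)%E.
      by rewrite product_measure1E//= pK mule0.
    by rewrite -[X in (_ <= X)%E]adde0; exact: (leeD e1 e2).
  rewrite -U0; apply: le_measure; rewrite ?inE.
  - exact: measurable_far.
  - by apply: measurableU; exact: measurableX.
  move=> [x y] /= xy; have [Kx|nKx] := pselect (K x); last by left.
  have [Ky|nKy] := pselect (K y); last by right.
  by move: xy; rewrite ltNge Krho.
apply: (@le_trans _ _ (ereal_sup [set (enorm (z.1 - z.2)%R)%:E | z in support2 pi])).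
  apply: ereal_inf_lbound; exists pi => //; split=> A mA; rewrite piE.
    apply: etrans (esym (muE A mA)).
    rewrite (_ : fst @^-1` A = A `*` setT); last by apply/seteqP; split => -[? ?] //= [].
    rewrite product_measure1E//= muleCA PK mule1.
    by rewrite (_ : _ @^-1` _ = A)//; apply/seteqP; split => x //= [].
  apply: etrans (esym (nuE A mA)).
  rewrite (_ : snd @^-1` A = setT `*` A); last by apply/seteqP; split => -[? ?] //= [].
  rewrite product_measure1E//= muleA -pq PK mul1e.
  by rewrite (_ : _ @^-1` _ = A)//; apply/seteqP; split => x //= [].
apply: ge_ereal_sup => _ [z zpi <-]; rewrite lee_fin.
exact: support2_near pi_far zpi.
Qed.

End transport.

(** * Second variation of the energy *)

(** By the parallelogram identity for the quadratic form with the nine given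
    entries, applied to [r + 2p], [r + 2q] and their midpoint [r + p + q].
    Finiteness at the midpoint forces all nine entries to be finite. *)
Lemma quadratic_second_difference (R : realDomainType)
    (rr rp rq pr pp pq qr qp qq : \bar R) :
  let sum := (rr + rp + rq + (pr + pp + pq) + (qr + qp + qq))%E in
  sum \is a fin_num ->
  (sum <= rr + rp + rp + (pr + pp + pp) + (pr + pp + pp))%E ->
  (sum <= rr + rq + rq + (qr + qq + qq) + (qr + qq + qq))%E ->
  (pq + qp <= pp + qq)%E.
Proof.
move=> sum; rewrite /sum !fin_numD => /andP[/andP[/andP[/andP[]]]].
do 3 move=> /EFin_fin_numP[? ->].
move=> /andP[/andP[]]; do 3 move=> /EFin_fin_numP[? ->].
move=> /andP[/andP[]]; do 3 move=> /EFin_fin_numP[? ->].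
by rewrite -!EFinD !lee_fin; lra.
Qed.

Section second_variation.
Context {R : realType} {N : nat}.
Local Notation RN := 'rV[R]_N.
Implicit Types (a b p q r s : {finite_measure set RN -> \bar R}).

Lemma finite_measure_add a b :
  {s : {finite_measure set RN -> \bar R} | forall A, s A = (a A + b A)%E}.
Proof.
have abfin : (measure_add a b setT < +oo)%E.
  rewrite measure_addE ltey_eq fin_numD; apply/orP; left.
  by apply/andP; split; exact: fin_num_measure.
have [s sE] := finite_measure_of abfin.
by exists s => A; rewrite sE; exact: measure_addE.
Qed.

Lemma probability_add (mu : probability RN R) a b (c : {finite_measure set RN -> \bar R}) :
  (forall A, measurable A -> mu A = (a A + b A)%E) -> b setT = c setT ->
  {nu : probability RN R | forall A, nu A = (a A + c A)%E}.
Proof.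
move=> muE bc.
have acT : (measure_add a c setT = 1)%E.
  rewrite -(probability_setT mu).
  by apply: etrans (measure_addE _ _ _) _; rewrite /= -bc; exact/esym/muE.
have [nu nuE] := probability_of acT.
by exists nu => A; rewrite nuE; exact: measure_addE.
Qed.

Section expand.
Variable w : RN -> R.
Hypothesis w0 : forall x, 0 <= w x.
Hypothesis cw : continuous w.
Local Notation I := (interaction w).

Lemma interaction3 (m : {finite_measure set RN -> \bar R}) r p q :
  (forall A, measurable A -> m A = (r A + p A + q A)%E) ->
  I m m = (I r r + I r p + I r q + (I p r + I p p + I p q)
           + (I q r + I q p + I q q))%E.
Proof.
move=> mE; have [s sE] := finite_measure_add r p.
have msq A : measurable A -> m A = (s A + q A)%E by move=> /mE; rewrite sE.
have exr b : I b m = (I b r + I b p + I b q)%E.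
  rewrite (interactionDr w0 cw b msq); congr (_ + _)%E.
  by apply: interactionDr.
rewrite (interactionDl w0 cw m msq) (interactionDl w0 cw m (fun A _ => sE A)).
by rewrite !exr.
Qed.

End expand.

Variables (W : RN -> R) (M : R) (mu : probability RN R).
Hypothesis cW : continuous W.
Hypothesis M0 : 0 <= M.
Hypothesis WM : forall x, - M <= W x.
Let w x := W x + M.
Local Notation I := (interaction w).

Let w0 x : 0 <= w x. Proof. by have := WM x; rewrite /w; lra. Qed.

Let cw : continuous w.
Proof. by move=> x; apply: continuousD; [exact: cW|exact: cst_continuous]. Qed.

Lemma le_interaction_energy (nu : probability RN R) :
  (interaction_energy W mu <= interaction_energy W nu -> I mu mu <= I nu nu)%E.
Proof.
rewrite !(interaction_energyE _ cW M0 WM) -/w.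
by rewrite lee_pmul2l// leeD2rE.
Qed.

Lemma lty_interaction_energy :
  (interaction_energy W mu < +oo -> I mu mu < +oo)%E.
Proof.
rewrite (interaction_energyE _ cW M0 WM) -/w.
have := interaction_ge0 w0 mu mu.
case: (I mu mu) => [x _ _|_|]//; first exact: ltry.
by rewrite addye// gt0_muley// lte_fin.
Qed.

(** Compare [mu] with [r + 2p] and [r + 2q] and add up: the two competitors are
    symmetric about [mu], so only the second-order term survives. *)
Lemma second_variation (delta rho : R) r p q (K : set RN) :
  (interaction_energy W mu < +oo)%E ->
  (forall nu : probability RN R, (dinfty mu nu < delta%:E)%E ->
    (interaction_energy W mu <= interaction_energy W nu)%E) ->
  (forall A, measurable A -> mu A = (r A + p A + q A)%E) ->
  p setT = q setT -> (0 < p setT)%E ->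
  measurable K -> p (~` K) = 0%E -> q (~` K) = 0%E -> 0 <= rho < delta ->
  (forall x y, K x -> K y -> enorm (x - y) <= rho) ->
  (I p q + I q p <= I p p + I q q)%E.
Proof.
move=> Efin Emin muE pq p0 mK pK qK /andP[rho0 rhodelta] Krho.
have step (p' q' s : {finite_measure set RN -> \bar R}) :
    (forall A, s A = (r A + p' A)%E) ->
    (forall A, measurable A -> mu A = (s A + q' A)%E) ->
    p' setT = q' setT -> (0 < p' setT)%E ->
    p' (~` K) = 0%E -> q' (~` K) = 0%E ->
    exists2 nu : probability RN R,
      (forall A, measurable A -> nu A = (r A + p' A + p' A)%E) &
      (I mu mu <= I nu nu)%E.
  move=> sE muE' p'q' p'0 p'K q'K.
  have [nu nuE] := probability_add muE' (esym p'q').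
  exists nu; first by move=> A _; rewrite nuE sE.
  apply: le_interaction_energy; apply: Emin.
  apply: (@le_lt_trans _ _ rho%:E); last by rewrite lte_fin.
  by apply: (@dinfty_le _ _ mu nu s p' q' K) => // A _; exact: nuE.
have [s1 s1E] := finite_measure_add r p.
have [s2 s2E] := finite_measure_add r q.
have mu1 A : measurable A -> mu A = (s1 A + q A)%E by move=> mA; rewrite s1E muE.
have mu2 A : measurable A -> mu A = (s2 A + p A)%E.
  by move=> mA; rewrite s2E muE// addeAC.
have [nu1 nu1E le1] := step p q s1 s1E mu1 pq p0 pK qK.
have q0 : (0 < q setT)%E by rewrite -pq.
have [nu2 nu2E le2] := step q p s2 s2E mu2 (esym pq) q0 qK pK.
have muoo := lty_interaction_energy Efin.
have : I mu mu \is a fin_num by rewrite ge0_fin_numE ?interaction_ge0.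
move: le1 le2.
rewrite (interaction3 w0 cw muE) (interaction3 w0 cw nu1E) (interaction3 w0 cw nu2E).
by move=> le1 le2 mufin; exact: quadratic_second_difference mufin le1 le2.
Qed.

End second_variation.

(** * Three points of the support *)

Section three_points.
Context {R : realType} {N : nat}.
Local Notation RN := 'rV[R]_N.
Implicit Types (x y : RN) (mu : probability RN R).

(** Membership of [x] in the support of [mu], tested on sup-norm balls. *)
Definition charges mu x := forall e : R, 0 < e -> (0 < mu (ball x e))%E.

Lemma measurable_ball_rV x (e : R) : measurable (ball x e).
Proof. by apply: measurable_open_rV; exact: ball_open. Qed.

Lemma near_pair (P : RN -> RN -> Prop) x y :
  (\forall z \near (x, y), P z.1 z.2) ->
  \forall e \near 0^'+, forall x' y', ball x e x' -> ball y e y' -> P x' y'.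
Proof.
move=> /nbhs_ballP[d /= d0 dP]; near=> e => x' y' xx' yy'.
have ed : e <= d by near: e; exact: nbhs_right_le.
by apply: (dP (x', y')); split; [exact: (le_ball ed xx')|exact: (le_ball ed yy')].
Unshelve. all: by end_near. Qed.

(** The mass [s] to be moved is a multiple of the restriction of [mu] to [V].
    The fraction [t] lets the pieces taken around several points fit together
    under [mu], even if their neighbourhoods overlap: it suffices that the
    fractions add up to [1]. *)
Lemma split_mass mu (V : set RN) (t s : R) :
  measurable V -> 0 < s -> (s%:E <= t%:E * mu V)%E ->
  exists ab : {finite_measure set RN -> \bar R} * {finite_measure set RN -> \bar R},
  [/\ forall A, measurable A -> (t%:E * mu A = ab.1 A + ab.2 A)%E,
      ab.1 setT = s%:E & ab.1 (~` V) = 0%E].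
Proof.
move=> mV s0 stV.
have mVC : measurable (~` V) by exact: measurableC.
have Vfin : mu V \is a fin_num by exact: fin_num_measure.
pose v := fine (mu V); have vE : mu V = v%:E by rewrite fineK.
have v0 : 0 < v.
  have : 0 <= v by rewrite fine_ge0.
  rewrite le_eqVlt => /predU1P[v0|//].
  by move: stV; rewrite vE -v0 mule0 lee_fin leNgt s0.
have t0 : 0 < t.
  move: stV; rewrite vE -EFinM lee_fin => /(lt_le_trans s0).
  by rewrite pmulr_lgt0.
have c0 : 0 <= s / v by rewrite divr_ge0// ltW.
have tc0 : 0 <= t - s / v.
  by move: stV; rewrite vE -EFinM lee_fin subr_ge0 ler_pdivrMr.
pose mV' : {finite_measure set RN -> \bar R} := mrestr mu mV.
pose mVC' : {finite_measure set RN -> \bar R} := mrestr mu mVC.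
pose a : {finite_measure set RN -> \bar R} := mscale (NngNum c0) mV'.
pose b1 : {finite_measure set RN -> \bar R} := mscale (NngNum tc0) mV'.
pose b2 : {finite_measure set RN -> \bar R} := mscale (NngNum (ltW t0)) mVC'.
have [b bE] := finite_measure_add b1 b2.
exists (a, b); split => /=.
- move=> A mA; rewrite bE /= /mscale /= /mrestr.
  set x := (X in ((s / v)%:E * X)%E); set y := (X in (_ + (_ + t%:E * X))%E).
  rewrite -[X in ((t - s / v)%:E * X)%E]/x.
  have xfin : x \is a fin_num by exact: (fin_num_measure mu _ (measurableI _ _ mA mV)).
  have yfin : y \is a fin_num by exact: (fin_num_measure mu _ (measurableI _ _ mA mVC)).
  have -> : (mu A = x + y)%E by rewrite addeC; exact: (measureDI mu mA mV).
  case/EFin_fin_numP: xfin => x' ->; case/EFin_fin_numP: yfin => y' ->.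
  by rewrite -EFinD -!EFinM -!EFinD; congr EFin; ring.
- by rewrite /mscale /= /mrestr setTI vE -EFinM divfK// gt_eqF.
- by rewrite /mscale /= /mrestr setICl measure0 mule0.
Qed.

Lemma carve_masses mu (V1 V2 V0 : set RN) :
  measurable V1 -> measurable V2 -> measurable V0 ->
  (0 < mu V1)%E -> (0 < mu V2)%E -> (0 < mu V0)%E ->
  exists (s : R) (r a1 a2 q : {finite_measure set RN -> \bar R}),
    [/\ 0 < s,
        forall A, measurable A -> mu A = (r A + (a1 A + a2 A) + q A)%E,
        [/\ a1 setT = s%:E, a2 setT = s%:E & q setT = (2 * s)%:E] &
        [/\ a1 (~` V1) = 0%E, a2 (~` V2) = 0%E & q (~` V0) = 0%E]].
Proof.
move=> mV1 mV2 mV0 V1_gt0 V2_gt0 V0_gt0.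
(* A quarter of [mu] serves each of [V1] and [V2], the remaining half serves
   [V0], which has to give away twice as much. *)
have [s s0 [s1 s2 s00]] : exists2 s : R, 0 < s &
    [/\ (s%:E <= (4^-1)%:E * mu V1)%E, (s%:E <= (4^-1)%:E * mu V2)%E &
        ((2 * s)%:E <= (2^-1)%:E * mu V0)%E].
  move: V1_gt0 V2_gt0 V0_gt0.
  have := fin_num_measure mu _ mV1; have := fin_num_measure mu _ mV2.
  have := fin_num_measure mu _ mV0 => /=.
  move=> /EFin_fin_numP[v0 ->] /EFin_fin_numP[v2 ->] /EFin_fin_numP[v1 ->].
  rewrite !lte_fin => v10 v20 v00.
  exists (Num.min v0 (Num.min v1 v2) / 4).
    by rewrite divr_gt0// !lt_min v00 v10 v20.
  set v := Num.min v0 _.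
  have [l0 l1 l2] : [/\ v <= v0, v <= v1 & v <= v2].
    by rewrite /v !ge_min !lexx !orbT.
  by split; rewrite -EFinM lee_fin; lra.
have [[a1 b1] /= [ab1 a1T a1V]] := split_mass mV1 s0 s1.
have [[a2 b2] /= [ab2 a2T a2V]] := split_mass mV2 s0 s2.
have s20 : 0 < 2 * s by rewrite mulr_gt0.
have [[q b0] /= [ab0 qT qV]] := split_mass mV0 s20 s00.
have [b12 b12E] := finite_measure_add b1 b2.
have [r rE] := finite_measure_add b12 b0.
exists s, r, a1, a2, q; split => // A mA; rewrite rE b12E.
have -> : (mu A = (4^-1)%:E * mu A + (4^-1)%:E * mu A + (2^-1)%:E * mu A)%E.
  have /EFin_fin_numP[x ->] := fin_num_measure mu A mA.
  by rewrite -!EFinM -!EFinD; congr EFin; lra.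
rewrite {1}ab1// ab2// ab0//.
by rewrite [LHS](AC (2*2*2) ((2*4*6)*(1*3)*5)).
Qed.

Lemma null_setC (a : {finite_measure set RN -> \bar R}) (A B : set RN) :
  measurable A -> measurable B -> A `<=` B -> a (~` A) = 0%E -> a (~` B) = 0%E.
Proof.
move=> mA mB AB aA; apply: (@subset_measure0 _ _ _ a _ (~` A)) => //.
- exact: measurableC.
- exact: measurableC.
- exact: subsetC.
Qed.

(** Put mass [s] near each of [x1], [x2] and mass [2 s] near [x0]. The
    coefficients are those of the quadratic form of [W] at
    [delta_x1 + delta_x2 - 2 delta_x0], and the contributions of the constant
    added to [W] cancel because this combination has total mass zero. *)
Lemma three_point_condition (W : RN -> R) mu :
  continuous W -> (exists m, forall x, m <= W x) ->
  (interaction_energy W mu < +oo)%E -> local_minimizer W mu ->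
  exists2 delta : R, 0 < delta & forall x1 x2 x0,
    charges mu x1 -> charges mu x2 -> charges mu x0 ->
    enorm (x1 - x2) < delta -> enorm (x1 - x0) < delta ->
    enorm (x2 - x0) < delta ->
    2 * (W (x1 - x0) + W (x0 - x1) + W (x2 - x0) + W (x0 - x2)) <=
    6 * W 0 + W (x1 - x2) + W (x2 - x1).
Proof.
move=> cW [m Wm] Efin [delta delta0 Emin].
exists (delta / 2); first by rewrite divr_gt0.
move=> x1 x2 x0 c1 c2 c0 d12 d10 d20.
rewrite leNgt; apply/negP => S0.
(* One more than needed for [W + M >= 0], to leave room for [eps] below. *)
pose M := `|m| + 1.
have M0 : 0 <= M by rewrite addr_ge0.
have WM x : 1 - M <= W x.
  by apply: le_trans (Wm x); rewrite /M; have := ler_norm (- m); rewrite normrN; lra.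
have WM' x : - M <= W x by have := WM x; lra.
pose w x := W x + M.
have w1 x : 1 <= w x by have := WM x; rewrite /w; lra.
have w0 x : 0 <= w x by have := w1 x; lra.
have cw : continuous w.
  by move=> x; exact: (continuousD (cW x) (@cst_continuous _ _ M x)).
pose S := 2 * (W (x1 - x0) + W (x0 - x1) + W (x2 - x0) + W (x0 - x2)) -
    (6 * W 0 + W (x1 - x2) + W (x2 - x1)).
have Spos : 0 < S by rewrite /S subr_gt0.
(* Replacing [W] at the centres by [W] on the balls costs at most
   [16 * eps * s ^ 2]: half of it from [p p] and [q q], half from [p q] and
   [q p]. *)
pose eps := Num.min 1 (S / 17).
have eps0 : 0 < eps by rewrite lt_min ltr01 divr_gt0.
have eps1 : eps <= 1 by rewrite ge_min lexx.
have epsS : eps <= S / 17 by rewrite ge_min lexx orbT.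
(* Everything below takes place on balls small enough for these three
   conditions to hold between any two of them. *)
pose close x y x' y' :=
  [/\ w (x - y) - eps <= w (x' - y'), w (x' - y') <= w (x - y) + eps &
      enorm (x' - y') <= delta / 2].
pose close_balls e x y :=
  forall x' y', ball x e x' -> ball y e y' -> close x y x' y'.
have near_close x y : enorm (x - y) < delta / 2 ->
    \forall e \near 0^'+, close_balls e x y.
  move=> xy; apply: near_pair.
  have csub (f : RN -> R) : continuous f ->
      (fun z : RN * RN => f (z.1 - z.2)) @ (x, y) --> f (x - y).
    move=> cf; apply: (@cvg_comp _ _ _ (fun z : RN * RN => z.1 - z.2) f _ (nbhs (x - y))).
      by apply: cvgB; [exact: cvg_fst|exact: cvg_snd].
    exact: cf.
  have cwsub := csub _ cw.
  have cesub := csub _ (@continuous_enorm R N).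
  near=> z; split; near: z.
  - by apply: (cvgr_ge _ cwsub); lra.
  - by apply: (cvgr_le _ cwsub); lra.
  - exact: (cvgr_le _ cesub).
have dNN x y : enorm (x - y) < delta / 2 -> enorm (y - x) < delta / 2.
  by rewrite -enormN opprB.
have d00 x : enorm (x - x) < delta / 2 by rewrite subrr enorm0 divr_gt0.
have PF : ProperFilter (0 : R)^'+ by exact: _.
pose conj P Q := @filterI R _ PF P Q.
have e_gt0 : \forall e \near (0 : R)^'+, 0 < e by exact: nbhs_right_gt.
have [e [e0 [[E11 [E22 E00]] [[E12 [E10 E20]] [E21 [E01 E02]]]]]] :=
  @filter_ex _ _ PF _ (conj _ _ e_gt0 (conj _ _
    (conj _ _ (near_close _ _ (d00 x1))
      (conj _ _ (near_close _ _ (d00 x2)) (near_close _ _ (d00 x0))))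
    (conj _ _
      (conj _ _ (near_close _ _ d12) (conj _ _ (near_close _ _ d10) (near_close _ _ d20)))
      (conj _ _ (near_close _ _ (dNN _ _ d12))
        (conj _ _ (near_close _ _ (dNN _ _ d10)) (near_close _ _ (dNN _ _ d20))))))).
pose V1 := ball x1 e; pose V2 := ball x2 e; pose V0 := ball x0 e.
have mV1 : measurable V1 by exact: measurable_ball_rV.
have mV2 : measurable V2 by exact: measurable_ball_rV.
have mV0 : measurable V0 by exact: measurable_ball_rV.
have [s [r [a1 [a2 [q [s0 masses [a1T a2T qT] [a1V a2V qV]]]]]]] :=
  carve_masses mV1 mV2 mV0 (c1 e e0) (c2 e e0) (c0 e e0).
have s20 : 0 < 2 * s by rewrite mulr_gt0.
have [p pE] := finite_measure_add a1 a2.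
pose K := V1 `|` V2 `|` V0.
have mK : measurable K by do 2 (apply: measurableU => //).
have V1K : V1 `<=` K by move=> x; left; left.
have V2K : V2 `<=` K by move=> x; left; right.
have V0K : V0 `<=` K by move=> x; right.
have muE A : measurable A -> mu A = (r A + p A + q A)%E.
  by move=> mA; rewrite pE masses.
have pT : p setT = (2 * s)%:E by rewrite pE a1T a2T -EFinD; congr EFin; ring.
have pK : p (~` K) = 0%E.
  by rewrite pE (null_setC mV1 mK V1K a1V) (null_setC mV2 mK V2K a2V) adde0.
have qK : q (~` K) = 0%E by exact: (null_setC mV0 mK V0K qV).
have p0 : (0 < p setT)%E by rewrite pT lte_fin.
have rho_delta : 0 <= delta / 2 < delta.
  by rewrite divr_ge0 ?ltW//= ltr_pdivrMr// mulr_natr mulr2n ltrDl.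
have Krho x y : K x -> K y -> enorm (x - y) <= delta / 2.
  case=> [[]|] Kx [[]|] Ky.
  - by have [] := E11 _ _ Kx Ky.
  - by have [] := E12 _ _ Kx Ky.
  - by have [] := E10 _ _ Kx Ky.
  - by have [] := E21 _ _ Kx Ky.
  - by have [] := E22 _ _ Kx Ky.
  - by have [] := E20 _ _ Kx Ky.
  - by have [] := E01 _ _ Kx Ky.
  - by have [] := E02 _ _ Kx Ky.
  - by have [] := E00 _ _ Kx Ky.
have := second_variation cW M0 WM' Efin Emin muE (etrans pT (esym qT)) p0
  mK pK qK rho_delta Krho.
rewrite -/w.
rewrite (interactionDl w0 cw p (fun A _ => pE A)).
rewrite !(interactionDr w0 cw _ (fun A _ => pE A)) (interactionDl w0 cw q (fun A _ => pE A)).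
apply/negP; rewrite -ltNge.
have le_I (a b : {finite_measure set RN -> \bar R}) (sa sb : R) A B x y :
    measurable A -> measurable B ->
    a (~` A) = 0%E -> b (~` B) = 0%E -> a setT = sa%:E -> b setT = sb%:E ->
    (forall x' y', A x' -> B y' -> close x y x' y') ->
    (interaction w a b <= ((w (x - y) + eps) * (sa * sb))%:E)%E.
  move=> mA mB aA bB aT bT AB; rewrite !EFinM -aT -bT.
  apply: (interaction_le w0 cw mA mB aA bB).
    by rewrite addr_ge0// ltW.
  by move=> x' y' Ax' By'; have [] := AB _ _ Ax' By'.
have ge_I (a b : {finite_measure set RN -> \bar R}) (sa sb : R) A B x y :
    measurable A -> measurable B ->
    a (~` A) = 0%E -> b (~` B) = 0%E -> a setT = sa%:E -> b setT = sb%:E ->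
    (forall x' y', A x' -> B y' -> close x y x' y') ->
    (((w (x - y) - eps) * (sa * sb))%:E <= interaction w a b)%E.
  move=> mA mB aA bB aT bT AB; rewrite !EFinM -aT -bT.
  apply: (interaction_ge w0 cw mA mB aA bB).
    by rewrite subr_ge0 (le_trans eps1).
  by move=> x' y' Ax' By'; have [] := AB _ _ Ax' By'.
have I11 := le_I _ _ _ _ _ _ _ _ mV1 mV1 a1V a1V a1T a1T E11.
have I12 := le_I _ _ _ _ _ _ _ _ mV1 mV2 a1V a2V a1T a2T E12.
have I21 := le_I _ _ _ _ _ _ _ _ mV2 mV1 a2V a1V a2T a1T E21.
have I22 := le_I _ _ _ _ _ _ _ _ mV2 mV2 a2V a2V a2T a2T E22.
have I00 := le_I _ _ _ _ _ _ _ _ mV0 mV0 qV qV qT qT E00.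
have I10 := ge_I _ _ _ _ _ _ _ _ mV1 mV0 a1V qV a1T qT E10.
have I20 := ge_I _ _ _ _ _ _ _ _ mV2 mV0 a2V qV a2T qT E20.
have I01 := ge_I _ _ _ _ _ _ _ _ mV0 mV1 qV a1V qT a1T E01.
have I02 := ge_I _ _ _ _ _ _ _ _ mV0 mV2 qV a2V qT a2T E02.
apply: le_lt_trans (leeD (leeD (leeD I11 I12) (leeD I21 I22)) I00) _.
apply: lt_le_trans (leeD (leeD I10 I20) (leeD I01 I02)).
rewrite -!EFinD lte_fin !subrr /w.
have Se : 17 * eps <= S by rewrite -ler_pdivlMl// mulrC.
have : 0 < s ^+ 2 by rewrite exprn_gt0.
move: Se; rewrite /S.
move: (W 0) (W (x1 - x0)) (W (x0 - x1)) (W (x2 - x0)) (W (x0 - x2)) (W (x1 - x2)) (W (x2 - x1)).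
move=> ? ? ? ? ? ? ? Se ss0.
nra.
Unshelve. all: by end_near.
Qed.

End three_points.

(** * Gram determinants *)

Section gram.
Context {R : rcfType}.

Lemma dotmx_ge0 n (v : 'rV[R]_n) : 0 <= (v *m v^T) 0 0.
Proof. by rewrite mxE sumr_ge0// => i _; rewrite mxE -expr2 sqr_ge0. Qed.

Lemma dotmx_eq0 n (v : 'rV[R]_n) : (v *m v^T) 0 0 = 0 -> v = 0.
Proof.
move=> v0; apply/rowP => i; rewrite mxE; apply/eqP; rewrite -sqrf_eq0.
apply/eqP/le_anti; rewrite sqr_ge0 andbT -v0 mxE (bigD1 i)//= mxE -expr2 lerDl.
by rewrite sumr_ge0// => j _; rewrite mxE -expr2 sqr_ge0.
Qed.

(** Along the segment from the identity to the Gram matrix, all matrices are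
    positive definite, hence invertible. The determinant is a polynomial in the
    parameter which is [1] at one end and never vanishes, so it is positive at
    the other end. *)
Lemma det_gram_gt0 k n (J : 'M[R]_(k, n)) : row_free J -> 0 < \det (J *m J^T).
Proof.
move=> Jfree; set G := J *m J^T; rewrite ltNge; apply/negP => G0.
pose P : 'M[{poly R}]_k :=
  'X *: 1%:M + (1 - 'X) *: map_mx polyC G.
have PE t : (\det P).[t] = \det (t *: 1%:M + (1 - t) *: G).
  rewrite -[LHS]/(horner_eval t _) -det_map_mx; congr (\det _).
  apply/matrixP => i j; rewrite /P !mxE /= /horner_eval !hornerE.
  by case: (i == j); rewrite ?hornerE.
have [|t /andP[t0 t1]] := @poly_ivt R (\det P) 0 1 ler01.
  by rewrite !PE scale0r add0r subr0 scale1r G0 scale1r subrr scale0r addr0 det1 ler01.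
rewrite rootE PE => /det0P[v /eqP vN0 vM]; apply: vN0.
have : (v *m (t *: 1%:M + (1 - t) *: G) *m v^T) 0 0 = 0 by rewrite vM mul0mx mxE.
rewrite mulmxDr mulmxDl -!scalemxAr -!scalemxAl mulmx1 /G !mulmxA -(mulmxA (v *m J)) -trmx_mul.
rewrite [LHS]mxE mxE [X in _ + X]mxE => sum0.
have vJ0 := dotmx_ge0 (v *m J); have v0 := dotmx_ge0 v.
have [tpos|] := ltP 0 t.
  apply: dotmx_eq0; apply: le_anti; rewrite v0 andbT.
  have : 0 <= (1 - t) * ((v *m J) *m (v *m J)^T) 0 0 by rewrite mulr_ge0// subr_ge0.
  by move=> h; rewrite -(pmulr_rle0 _ tpos); lra.
move=> tle; have tE : t = 0 by apply: le_anti; rewrite t0 tle.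
move: sum0; rewrite tE mul0r add0r subr0 mul1r => /dotmx_eq0 vJ.
by apply: (row_free_inj Jfree); rewrite vJ mul0mx.
Qed.

End gram.

(** * Surface measure of small pieces of a chart *)

Section integral_lower_bound.
Context d (T : measurableType d) (R : realType).
Local Open Scope ereal_scope.

(** The integral of a nonnegative function is the supremum of the integrals of
    the simple functions below it, and [c] times the indicator of [K] is one of
    them. In this form the bound applies to an integral over a manifold which is
    not known to be a Borel set. *)
Lemma ge0_integral_ge_cst (m : {measure set T -> \bar R})
    (D K : set T) (g : T -> \bar R) (c : R) :
  measurable K -> K `<=` D -> (0 <= c)%R -> (forall x, D x -> 0 <= g x) ->
  (forall x, K x -> c%:E <= g x) -> c%:E * m K <= \int[m]_(x in D) g x.
Proof.
move=> mK KD c0 g0 cg; rewrite -integral_cst// !ge0_integralE//.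
apply: le_ereal_sup => _ [h hle <-]; exists h => //= x.
apply: le_trans (hle x) _; rewrite /patch.
case: ifPn => [/set_mem Kx|_]; first by rewrite mem_set ?cg//; exact: KD.
by case: ifPn => // /set_mem; exact: g0.
Qed.

End integral_lower_bound.

Section boxes.
Context {R : realType}.

(** Closed cubes are used rather than open balls so that their images under a
    chart are compact, and therefore measurable. *)
Definition box n (c : 'rV[R]_n) (e : R) : set 'rV[R]_n :=
  [set x | forall i, `|c 0 i - x 0 i| <= e].

Lemma compact_box n (c : 'rV[R]_n) e : compact (box c e).
Proof.
have := @rV_compact R n (fun i => `[c 0 i - e, c 0 i + e]%classic)
  (fun i => @segment_compact R (c 0 i - e) (c 0 i + e)).
congr compact; apply/seteqP; split => x /= xi i; have := xi i.
  by rewrite /= in_itv /= ler_distlC.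
by rewrite /= in_itv /= ler_distlC.
Qed.

Lemma closed_compact_rV n (A : set 'rV[R]_n) : compact A -> closed A.
Proof. by apply: compact_closed; exact: norm_hausdorff. Qed.

Lemma measurable_compact_rV n (A : set 'rV[R]_n) : compact A -> measurable A.
Proof.
move=> /closed_compact_rV Ac; rewrite -[A]setCK; apply: measurableC.
by apply: measurable_open_rV; exact: closed_openC.
Qed.

Lemma box_ball n (c : 'rV[R]_n) (e e' : R) :
  0 < e' -> e < e' -> box c e `<=` ball c e'.
Proof.
move=> e'0 ee' x xe; split => // i j; rewrite ord1.
exact: le_lt_trans (xe j) ee'.
Qed.

Lemma lebesgue_box_gt0 n (c : 'rV[R]_n) (e : R) : 0 < e ->
  (0 < lebesgue_rV R n (box c e))%E.
Proof.
move=> e0; elim: n c => [|n IH] c.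
  by rewrite /= diracE mem_set// => -[].
pose c0 : R := c 0 (lshift n (0 : 'I_1) : 'I_(1 + n)).
pose c' : 'rV[R]_n := \row_j c 0 (rshift 1 j : 'I_(1 + n)).
have -> : lebesgue_rV R n.+1 (box c e) =
    ((@lebesgue_measure R \x lebesgue_rV R n) (@cons_rV R n @^-1` box c e))%E by [].
have -> : @cons_rV R n @^-1` box c e = `[c0 - e, c0 + e]%classic `*` box c' e.
  apply/seteqP; split => [[x y] /= xy|[x y] /= [xc yc] i].
    split.
      have := xy (lshift n (0 : 'I_1)).
      by rewrite [cons_rV _ _ _]row_mxEl mxE in_itv /= ler_distlC.
    by move=> i; have := xy (rshift 1 i); rewrite [cons_rV _ _ _]row_mxEr mxE.
  have [j ->|j ->] := split_ordP (i : 'I_(1 + n)).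
    by rewrite [cons_rV _ _ _]row_mxEl mxE ord1; move: xc; rewrite in_itv /= -ler_distlC.
  by rewrite [cons_rV _ _ _]row_mxEr; have := yc j; rewrite mxE.
rewrite product_measure1E//; last first.
  by apply: measurable_compact_rV; exact: compact_box.
apply: mule_gt0; last exact: IH.
have : (0 < lebesgue_measure (`[(c0 - e)%R, (c0 + e)%R]%classic : set R))%E.
  rewrite lebesgue_measure_itv /= lte_fin ifT; last by lra.
  by rewrite -EFinB lte_fin; lra.
by [].
Qed.

End boxes.

Lemma near_eq_continuous (R : realType) (T : topologicalType) (g h : T -> R) (x : T) :
  (\forall y \near x, g y = h y) -> h y @[y --> x] --> h x -> g y @[y --> x] --> g x.
Proof.
move=> gh hx; rewrite (nbhs_singleton gh); apply: cvg_trans hx.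
by apply: near_eq_cvg; near=> y; apply/esym; near: y.
Unshelve. all: by end_near. Qed.

Lemma cvg_det_gram (R : realType) (T : Type) (F : set_system T) (FF : Filter F)
    k n (A : T -> 'M[R]_(k, n)) (B : 'M[R]_(k, n)) :
  (forall i j, (fun x => A x i j) @ F --> B i j) ->
  (fun x => \det (A x *m (A x)^T)) @ F --> \det (B *m B^T).
Proof.
move=> AB; apply: cvg_det => i j.
rewrite mxE; under eq_fun do rewrite mxE.
apply: cvg_sumr => l; rewrite mxE; under eq_fun do rewrite mxE.
by apply: cvgM; exact: AB.
Qed.

Section surface.
Context {R : realType} {N k : nat}.
Local Notation RN := 'rV[R]_N.
Local Notation Rk := 'rV[R]_k.
Implicit Types (U : set Rk) (phi : Rk -> RN) (u : Rk).

Lemma area_element_gt0 phi u : row_free ('J phi u) -> 0 < area_element phi u.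
Proof. by move=> Jfree; rewrite sqrtr_gt0; exact: det_gram_gt0. Qed.

Lemma jacobian_coord phi u i j : differentiable phi u ->
  'J phi u i j = 'D_(delta_mx 0 i) phi u 0 j.
Proof. by move=> dphi; rewrite deriveEjacobian// -rowE [RHS]mxE. Qed.

Lemma cvg_coord (T : Type) (F : set_system T) (FF : Filter F) (f : T -> RN) (l : RN) j :
  f @ F --> l -> (fun x => f x 0 j) @ F --> l 0 j.
Proof.
move=> fl; apply: (@cvg_comp _ _ _ f (fun y : RN => y 0 j) _ (nbhs l)) => //.
exact: coord_continuous.
Qed.

(** On the open set [U] the rows of the Jacobian matrix are the partial
    derivatives of [phi], which are continuous. *)
Lemma continuous_area_element U phi u : open U -> C1_on U phi -> U u ->
  area_element phi x @[x --> u] --> area_element phi u.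
Proof.
move=> oU [dphi cphi] Uu.
have cJ i j : (fun x => 'J phi x i j : R) @ u --> ('J phi u i j : R).
  apply: (@near_eq_continuous R Rk (fun x => 'J phi x i j)
    (fun x => 'D_(delta_mx 0 i) phi x 0 j) u).
    near=> x; apply: jacobian_coord; apply: dphi.
    by near: x; exact: open_nbhs_nbhs.
  exact: cvg_coord j (cphi (delta_mx 0 i) u Uu).
apply: (@cvg_comp _ _ _ (fun x => \det ('J phi x *m ('J phi x)^T)) Num.sqrt _
  (nbhs (\det ('J phi u *m ('J phi u)^T)))); last exact: sqrt_continuous.
exact: (@cvg_det_gram _ _ (nbhs u) _ _ _ (jacobian phi)).
Unshelve. all: by end_near. Qed.

(** The set [K] is the image of a cube on which the area element stays above a
    positive constant. *)
Lemma chart_image_measure_gt0 (M : set RN) (sigma : {measure set RN -> \bar R})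
    U phi u (V : set RN) :
  surface_measure k M sigma -> chart M U phi -> U u -> nbhs (phi u) V ->
  exists K : set RN, [/\ measurable K, K `<=` M `&` V & (0 < sigma K)%E].
Proof.
move=> [_ sigmaE] chartU Uu Vu.
have := chartU; case=> oU [C1phi _] Jfree phi_inj phi_open.
have [dphi _] := C1phi.
have [a au aE] : exists2 a : R, 0 < a & a < area_element phi u.
  have au := area_element_gt0 (Jfree u Uu).
  by exists (area_element phi u / 2); rewrite ?divr_gt0//; lra.
have : \forall x \near u, [/\ U x, V (phi x) & a <= area_element phi x].
  near=> x; split; near: x.
  - exact: open_nbhs_nbhs.
  - exact: (differentiable_continuous (dphi u Uu)).
  - exact: (cvgr_ge _ (continuous_area_element oU C1phi Uu)).
move=> /nbhs_ballP[d /= d0 ud].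
pose B := box u (d / 2).
have d20 : 0 < d / 2 by rewrite divr_gt0.
have Bud : B `<=` ball u d by apply: box_ball; lra.
have BU : B `<=` U by move=> x /Bud /ud [].
have mB : measurable B by apply: measurable_compact_rV; exact: compact_box.
exists (phi @` B); split.
- apply: measurable_compact_rV; apply: continuous_compact; last exact: compact_box.
  apply: continuous_in_subspaceT => x /set_mem Bx.
  exact: (differentiable_continuous (dphi x (BU x Bx))).
- move=> _ [x Bx <-]; split; last by have [] := ud _ (Bud _ Bx).
  have [C oC CE] := phi_open U oU (fun _ h => h).
  have : (phi @` U) (phi x) by exists x => //; exact: BU.
  by rewrite CE => -[].
rewrite (sigmaE U phi chartU B mB BU).
apply: (@lt_le_trans _ _ (a%:E * lebesgue_rV R k B)%E).
  by apply: mule_gt0; [rewrite lte_fin|exact: lebesgue_box_gt0].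
have area_ge0 x : B x -> (0 <= (area_element phi x)%:E)%E.
  by move=> _; rewrite lee_fin; exact: sqrtr_ge0.
have area_ge x : B x -> (a%:E <= (area_element phi x)%:E)%E.
  by move=> Bx; rewrite lee_fin; have [] := ud _ (Bud _ Bx).
exact: (@ge0_integral_ge_cst _ _ _ (lebesgue_rV R k) B B _ a mB (@subset_refl _ B)
  (ltW au) area_ge0 area_ge).
Unshelve. all: by end_near. Qed.

(** * The support of a measure with a regular part *)

(** Test [mu2] against a bump function around [phi u]: its integral is at least
    that of a positive constant over a piece of the manifold of positive
    surface measure, whereas it would vanish if [mu2] did not charge the
    ball. *)
Lemma regular_part_charges (mu : probability RN R) : regular_part k mu ->
  exists U phi, [/\ open U, U !=set0, (forall u, U u -> differentiable phi u),
    (forall u, U u -> row_free ('J phi u)) &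
    (forall u, U u -> charges mu (phi u))].
Proof.
case=> mu1 [mu2 [sigma [M [f]]]] [muE [Msub sigmaM] [f0 _ _] psiE].
case=> x0 [c [kappa [Mx0 c0 kappa0 fc]]].
have [U [phi [chartU [u0 Uu0 u0E]]]] := Msub _ Mx0.
have := chartU; case=> oU [[dphi _] _] Jfree phi_inj phi_open.
have nearball x : eball x0 kappa x -> nbhs x (eball x0 kappa).
  rewrite /eball /= => xk.
  have ce : enorm (y - x0) @[y --> x] --> enorm (x - x0).
    apply: (@continuous_comp _ _ _ (fun y : RN => y - x0) (@enorm R N)).
      by apply: continuousB; [exact: cvg_id|exact: cst_continuous].
    exact: continuous_enorm.
  exact: (cvgr_lt _ ce).
pose U' := U `&` phi @^-1` eball x0 kappa.
exists U', phi; split.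
- rewrite openE => x [Ux xk]; apply: filterI; first exact: open_nbhs_nbhs.
  exact: (differentiable_continuous (dphi x Ux)) (nearball _ xk).
- exists u0; split => //=; rewrite u0E /eball /= subrr enorm0//.
- by move=> u [Uu _]; exact: dphi.
- by move=> u [Uu _]; exact: Jfree.
move=> u [Uu phiu] e e0.
pose psi (y : RN) : R := Num.max 0 (e / 2 - `|phi u - y|).
have cpsi : continuous psi.
  move=> y; apply: (@continuous_max _ _ (fun=> 0) (fun y : RN => e / 2 - `|phi u - y|)).
    exact: cst_continuous.
  apply: continuousB; first exact: cst_continuous.
  apply: (@continuous_comp _ _ _ (fun y : RN => phi u - y) (@Num.norm R RN)).
    by apply: continuousB; [exact: cst_continuous|exact: cvg_id].
  exact: norm_continuous.
have psi_vanish : vanishing_continuous psi.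
  split=> // d d0; exists (N%:R * (`|phi u| + e)) => x xfar.
  have nx : `|phi u| + e < `|x|.
    have Nx := lt_le_trans xfar (enorm_le_norm x).
    rewrite ltNge; apply/negP => le_x; move: Nx; apply/negP; rewrite -leNgt.
    by rewrite ler_wpM2l.
  have := lerB_dist x (phi u); rewrite distrC => tri.
  by rewrite /psi max_l ?normr0//; lra.
have psi0 y : 0 <= psi y by rewrite le_max lexx.
have [K [mK KMV sK]] := chart_image_measure_gt0 sigmaM chartU Uu
  (filterI (nearball _ phiu) (nbhsx_ballx (phi u) (e / 4) ltac:(by rewrite divr_gt0))).
have psi_int : (0 < \int[mu2]_x (psi x)%:E)%E.
  rewrite psiE//.
  apply: (@lt_le_trans _ _ ((e / 4 * c)%:E * sigma K)%E).
    by apply: mule_gt0 => //; rewrite lte_fin mulr_gt0// divr_gt0.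
  apply: ge0_integral_ge_cst => //.
  - by move=> x /KMV[].
  - by rewrite mulr_ge0 ?divr_ge0// ltW.
  - by move=> x Mx; rewrite mule_ge0 ?lee_fin ?f0.
  - move=> x Kx; have [Mx [xk xe]] := KMV x Kx.
    rewrite EFinM; apply: lee_pmul; rewrite ?lee_fin ?divr_ge0 ?(ltW c0) ?(ltW e0)//.
      move: xe; rewrite -ball_normE /= => xe.
      by rewrite /psi le_max; apply/orP; right; lra.
    exact: fc.
have mB := measurable_ball_rV (phi u) e.
rewrite muE//; apply: (@lt_le_trans _ _ (mu2 (ball (phi u) e))); last by rewrite leeDr.
rewrite lt0e measure_ge0 andbT; apply/eqP => B0; move: psi_int.
rewrite (ge0_negligible_integral mB)//; last 2 first.
- by apply/measurable_EFinP; exact: measurable_continuous_rV.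
- by move=> x _; rewrite lee_fin.
rewrite (eq_integral (cst 0%E)) ?integral0 ?ltxx// => x /set_mem[_ xB].
congr EFin; rewrite /psi max_l// subr_le0.
move: xB; rewrite -ball_normE /= => /negP; rewrite -leNgt; lra.
Qed.

End surface.

(** * Nearly symmetric points on a curve *)

Lemma continuous_powR (R : realType) (alpha x : R) : 0 < x ->
  y `^ alpha @[y --> x] --> x `^ alpha.
Proof.
move=> x0; apply: (@near_eq_continuous R R _ (fun y => expR (alpha * ln y))).
  near=> y; rewrite /powR gt_eqF//; near: y; exact: lt_nbhsr.
apply: (@cvg_comp _ _ _ (fun y => alpha * ln y) expR _ (nbhs (alpha * ln x))).
  by apply: cvgM; [exact: cvg_cst|exact: continuous_ln].
exact: continuous_expR.
Unshelve. all: by end_near. Qed.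

Lemma cvg_enorm_powR (R : realType) n (T : Type) (F : set_system T) {FF : Filter F}
    (f : T -> 'rV[R]_n) (l : 'rV[R]_n) (alpha : R) : l != 0 ->
  f @ F --> l -> enorm (f x) `^ alpha @[x --> F] --> enorm l `^ alpha.
Proof.
move=> l0 fl.
apply: (@cvg_comp _ _ _ (fun x => enorm (f x)) (fun y => y `^ alpha) _ (nbhs (enorm l))).
  apply: (@cvg_comp _ _ _ f (@enorm R n) _ (nbhs l)) => //.
  exact: continuous_enorm.
by apply: continuous_powR; exact: enorm_gt0.
Qed.

Lemma ltr_enorm_powR_scale (R : realType) n (h alpha : R) (a b c : 'rV[R]_n) :
  h != 0 ->
  2 * enorm (h^-1 *: a) `^ alpha + 2 * enorm (h^-1 *: b) `^ alpha <
    enorm (h^-1 *: c) `^ alpha ->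
  2 * enorm a `^ alpha + 2 * enorm b `^ alpha < enorm c `^ alpha.
Proof.
move=> h0; rewrite !enormZ !powRM ?enorm_ge0// !(mulrCA 2) -mulrDr ltr_pM2l//.
by rewrite powR_gt0// normr_gt0 invr_eq0.
Qed.

Lemma power_law_arith (R : realFieldType) (alpha A B C : R) : 0 < alpha ->
  2 * B + 2 * C < A ->
  6 * 0 + - (A / alpha) + - (A / alpha) <
  2 * (- (B / alpha) + - (B / alpha) + - (C / alpha) + - (C / alpha)).
Proof.
move=> alpha0; rewrite -(ltr_pM2r (_ : 0 < alpha^-1)) ?invr_gt0//; lra.
Qed.

Section symmetric_points.
Context {R : realType} {N k : nat}.
Local Notation RN := 'rV[R]_N.
Local Notation Rk := 'rV[R]_k.

(** Dividing the three differences by [h], they converge to [2 v], [v] and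
    [- v], where [v] is the derivative in the direction [e]. The [alpha]-homogeneity
    of [W] near the origin reduces the claim to the limit inequality
    [4 |v|^alpha < (2 |v|)^alpha], which is where [2 < alpha] enters. *)
Lemma symmetric_chords (W : RN -> R) (alpha : R) (U : set Rk) (phi : Rk -> RN)
    (u e : Rk) (delta : R) (S : set RN) :
  (\forall x \near (0 : RN), W x = - (enorm x `^ alpha / alpha)) ->
  2 < alpha -> open U -> U u -> differentiable phi u -> 'D_e phi u != 0 ->
  0 < delta -> (forall x, U x -> S (phi x)) ->
  exists x1 x2 x0, [/\ S x1, S x2, S x0,
    [/\ enorm (x1 - x2) < delta, enorm (x1 - x0) < delta & enorm (x2 - x0) < delta] &
    6 * W 0 + W (x1 - x2) + W (x2 - x1) <
    2 * (W (x1 - x0) + W (x0 - x1) + W (x2 - x0) + W (x0 - x2))].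
Proof.
move=> Wnear alpha2 oU Uu dphi v0 delta0 US; set v := 'D_e phi u in v0.
have alpha0 : 0 < alpha by lra.
pose p (h : R) := phi (h *: e + u); pose m (h : R) := phi (h *: (- e) + u).
pose x0 := phi u.
have qp : h^-1 *: (p h - x0) @[h --> 0^'] --> v.
  exact: (@diff_derivable _ _ _ phi u e dphi).
have qm : h^-1 *: (m h - x0) @[h --> 0^'] --> - v.
  have -> : - v = 'D_(- e) phi u by rewrite /v !deriveE// linearN.
  exact: (@diff_derivable _ _ _ phi u (- e) dphi).
have qpm : h^-1 *: (p h - m h) @[h --> 0^'] --> 2 *: v.
  have -> : 2 *: v = v - - v by rewrite opprK scaler_nat mulr2n.
  rewrite (_ : (fun h => _) = fun h => h^-1 *: (p h - x0) - h^-1 *: (m h - x0)).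
    exact: cvgB.
  by apply/funext => h; rewrite -scalerBr opprB addrA subrK.
have to_u (w : Rk) : h *: w + u @[h --> (0 : R)^'] --> u.
  suff : h *: w + u @[h --> (0 : R)^'] --> 0 *: w + u by rewrite scale0r add0r.
  by apply: cvgD; [apply: cvgZr_tmp; exact: nbhs_dnbhs|exact: cvg_cst].
have cphi := differentiable_continuous dphi.
have pc : p h @[h --> 0^'] --> x0 by apply: cvg_comp (to_u e) cphi.
have mc : m h @[h --> 0^'] --> x0 by apply: cvg_comp (to_u (- e)) cphi.
have strict : \forall h \near (0 : R)^',
    2 * enorm (h^-1 *: (p h - x0)) `^ alpha +
    2 * enorm (h^-1 *: (m h - x0)) `^ alpha < enorm (h^-1 *: (p h - m h)) `^ alpha.
  have v20 : 2 *: v != 0 by rewrite scaler_eq0 negb_or v0 pnatr_eq0.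
  have vN0 : - v != 0 by rewrite oppr_eq0.
  have Ap : enorm (h^-1 *: (p h - x0)) `^ alpha @[h --> 0^'] --> enorm v `^ alpha.
    exact: cvg_enorm_powR.
  have Am : enorm (h^-1 *: (m h - x0)) `^ alpha @[h --> 0^'] --> enorm (- v) `^ alpha.
    exact: cvg_enorm_powR.
  have Apm : enorm (h^-1 *: (p h - m h)) `^ alpha @[h --> 0^'] -->
      enorm (2 *: v) `^ alpha.
    exact: cvg_enorm_powR.
  have : 0 < enorm (2 *: v) `^ alpha -
      (2 * enorm v `^ alpha + 2 * enorm (- v) `^ alpha).
    rewrite enormN enormZ ger0_norm// powRM ?enorm_ge0//.
    have vpos : 0 < enorm v `^ alpha by rewrite powR_gt0 ?enorm_gt0.
    rewrite -mulrDl -mulrBl mulr_gt0// subr_gt0.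
    have -> : (2 + 2 : R) = 2 `^ 2.
      by rewrite powR_mulrn// expr2 mulr_natr.
    rewrite /powR !gt_eqF// ltr_expR ltr_pM2r//.
    by apply: ln_gt0; rewrite ltr1n.
  move=> Lpos.
  have lim_diff : enorm (h^-1 *: (p h - m h)) `^ alpha -
      (2 * enorm (h^-1 *: (p h - x0)) `^ alpha +
       2 * enorm (h^-1 *: (m h - x0)) `^ alpha) @[h --> 0^'] -->
      enorm (2 *: v) `^ alpha - (2 * enorm v `^ alpha + 2 * enorm (- v) `^ alpha).
    exact: (cvgB Apm (cvgD (cvgM (cvg_cst (2 : R)) Ap) (cvgM (cvg_cst (2 : R)) Am))).
  by near=> h; rewrite -subr_gt0; near: h; exact: (cvgr_gt _ lim_diff).
have small (f : R -> RN) : f h @[h --> (0 : R)^'] --> (0 : RN) -> \forall h \near (0 : R)^',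
    [/\ enorm (f h) < delta, W (f h) = - (enorm (f h) `^ alpha / alpha) &
        W (- f h) = - (enorm (f h) `^ alpha / alpha)].
  move=> f0.
  have fN0 : - f h @[h --> 0^'] --> (0 : RN) by rewrite -[X in _ --> X]oppr0; exact: cvgN.
  have WN : \forall h \near (0 : R)^', W (- f h) = - (enorm (f h) `^ alpha / alpha).
    near=> h; have : W (- f h) = - (enorm (- f h) `^ alpha / alpha).
      by near: h; exact: fN0 Wnear.
    by rewrite enormN.
  have ef0 : enorm (f h) @[h --> 0^'] --> enorm (0 : RN).
    by apply: cvg_comp f0 _; exact: continuous_enorm.
  near=> h; split.
  - near: h; apply: (cvgr_lt _ ef0); by rewrite enorm0.
  - by near: h; exact: f0 Wnear.
  - by near: h; exact: WN.
have U1 : \forall h \near (0 : R)^', U (h *: e + u) /\ U (h *: (- e) + u).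
  have nU : nbhs u U by exact: open_nbhs_nbhs.
  by near=> h; split; near: h; [exact: to_u e _ nU|exact: to_u (- e) _ nU].
have dist0 (f g : R -> RN) : f h @[h --> 0^'] --> x0 -> g h @[h --> 0^'] --> x0 ->
    f h - g h @[h --> 0^'] --> (0 : RN).
  by move=> fx gx; rewrite -(subrr x0); exact: cvgB.
have cx0 : x0 @[_ --> (0 : R)^'] --> x0 by exact: cvg_cst.
have Sx0 : S x0 by exact: US.
have s12 := small (fun h => p h - m h) (dist0 p m pc mc).
have s10 := small (fun h => p h - x0) (dist0 p (fun=> x0) pc cx0).
have s20 := small (fun h => m h - x0) (dist0 m (fun=> x0) mc cx0).
have W0 : W 0 = 0.
  by rewrite (nbhs_singleton Wnear) enorm0 powR0 ?gt_eqF// mul0r oppr0.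
have hneq : \forall h \near (0 : R)^', h != 0 by exact: nbhs_dnbhs_neq.
have PF : ProperFilter (0 : R)^' by exact: _.
have [h [[[d12 W12 W21] [d10 W10 W01]] [[d20 W20 W02] [sh [[Up Um] h0]]]]] :=
  @filter_ex _ _ PF _ (@filterI _ _ PF _ _ (@filterI _ _ PF _ _ s12 s10)
    (@filterI _ _ PF _ _ s20 (@filterI _ _ PF _ _ strict (@filterI _ _ PF _ _ U1 hneq)))).
exists (p h), (m h), x0; split.
- exact: US.
- exact: US.
- by [].
- by split.
move: W21 W01 W02; rewrite !opprB => -> -> ->; rewrite W12 W10 W20 W0.
by move/(ltr_enorm_powR_scale h0): sh; exact: power_law_arith.
Unshelve. all: by end_near.
Qed.

End symmetric_points.

(** * Conclusion *)

Unset Implicit Arguments.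

Theorem theorem2 (R : realType) (N : nat) (W : 'rV[R]_N -> R) (alpha : R)
  (W_C2 : C2_on setT W)
  (W_radial : exists w : R -> R, forall x, W x = w (enorm x))
  (W_bounded_below : exists m : R, forall x, m <= W x)
  (W_origin : \forall x \near (0 : 'rV[R]_N),
     W x = - (enorm x `^ alpha / alpha))
  (alpha_gt2 : 2 < alpha)
  (mu : probability 'rV[R]_N R)
  (mu_finite_energy : (interaction_energy W mu < +oo)%E)
  (mu_local_minimizer : local_minimizer W mu) :
  forall k : nat, (1 <= k <= N)%N -> ~ regular_part k mu.
Proof.
move=> k /andP[k1 _] /regular_part_charges[U [phi [oU [u Uu] dphi Jfree muphi]]].
have cW : continuous W by move=> x; exact: differentiable_continuous (W_C2.1.1 x I).
have [delta delta0 three] :=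
  three_point_condition cW W_bounded_below mu_finite_energy mu_local_minimizer.
pose e : 'rV[R]_k := delta_mx 0 (Ordinal k1).
have De0 : 'D_e phi u != 0.
  rewrite deriveEjacobian; last exact: dphi.
  apply/eqP => eJ0; have /rowP /(_ (Ordinal k1)) : e = 0.
    by apply: (row_free_inj (Jfree u Uu)); rewrite eJ0 mul0mx.
  by rewrite !mxE !eqxx => /eqP; rewrite oner_eq0.
have [x1 [x2 [x0 [c1 c2 c0 [d12 d10 d20]]]]] :=
  symmetric_chords W_origin alpha_gt2 oU Uu (dphi u Uu) De0 delta0 muphi.
by rewrite ltNge three.
Qed.
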